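(* Let $A$ be a Banach algebra, let $B$ be a Banach $A$-bimodule and let $n\geq 1$. If $H^1(A,B^{(n+2)})=0$, then $H^1(A,B^{(n)})=0$.
   Context: For a Banach $A$-bimodule $E$, a derivation $D:A\to E$ is a bounded linear map with $D(xy)=xD(y)+D(x)y$ for all $x,y\in A$. $Z^1(A,E)$ is the space of derivations from $A$ into $E$, $N^1(A,E)$ is the subspace of inner derivations $\delta_e(a)=ae-ea$ ($e\in E$), and $H^1(A,E)=Z^1(A,E)/N^1(A,E)$. $B^{(n)}$ denotes the $n$-th dual of $B$ ($B^{(0)}=B$), which is a Banach $A$-bimodule via $\langle b^{(n)}a,b^{(n-1)}\rangle=\langle b^{(n)},ab^{(n-1)}\rangle$ and $\langle ab^{(n)},b^{(n-1)}\rangle=\langle b^{(n)},b^{(n-1)}a\rangle$ for $a\in A$, $b^{(n)}\in B^{(n)}$, $b^{(n-1)}\in B^{(n-1)}$. *)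

(* Defs.v *)
From HB Require Import structures.
From mathcomp Require Import all_boot all_order all_algebra complex.
From mathcomp Require Import all_classical reals topology normedtype.

Set Implicit Arguments.
Unset Strict Implicit.
Unset Printing Implicit Defensive.
Import Order.TTheory GRing.Theory Num.Theory.
Import numFieldNormedType.Exports.

Local Open Scope classical_set_scope.
Local Open Scope ring_scope.

Variant real_or_complex : numFieldType -> Prop :=
| RealScalars (R : realType) : real_or_complex R
| ComplexScalars (R : realType) : real_or_complex R[i].

Section ScalarTheory.

Local Open Scope complex_scope.

Let scalar_sup_real (R : realType) (S : set R) :
  S !=set0 -> ubound S !=set0 -> supremums S !=set0.
Proof.
move=> S0 [M SM]; exists (sup S); split.
  by apply: ub_le_sup; exists M.
by move=> y Sy; apply: ge_sup.
Qed.

Lemma scalar_sup (K : numFieldType) (hK : real_or_complex K) (S : set K) :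
  S !=set0 -> (forall x, S x -> 0 <= x) -> ubound S !=set0 ->
  supremums S !=set0.
Proof.
case: hK S => R S [x0 Sx0] S_ge0 [M SM].
  by apply: scalar_sup_real; [exists x0 | exists M].
have SE x : S x -> x = (complex.Re x)%:C.
  by move=> /S_ge0; case: x => a b; rewrite lecE /= => /andP[/eqP-> _].
pose T := [set r : R | S r%:C].
have [||s [ubs lbs]] := @scalar_sup_real _ T.
- by exists (complex.Re x0); rewrite /T /= -SE.
- exists (complex.Re M) => r /= /SM; case: (M) => a b.
  by rewrite lecE /= => /andP[].
exists s%:C; split.
  move=> x Sx; rewrite (SE _ Sx) lecR; apply: ubs.
  by rewrite /T /= -SE.
move=> [a b] uby; have := uby _ Sx0; rewrite (SE _ Sx0) !lecE /= => /andP[-> _].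
by apply: lbs => r /= /uby; rewrite lecE /= => /andP[].
Qed.

Let scalar_complete_real (R : realType) (F : set_system R) : ProperFilter F ->
  (forall e : R, 0 < e -> exists x, F [set y | `|x - y| < e]) ->
  exists l, forall e : R, 0 < e -> F [set y | `|l - y| < e].
Proof.
move=> FF cF; have /cvg_ex[l /cvgrPdist_lt Fl] : cvg F.
  by apply: R_complete; apply/cauchyP => e /cF.
by exists l => e e0; exact: Fl.
Qed.

Lemma scalar_complete (K : numFieldType) (hK : real_or_complex K)
    (F : set_system K) : ProperFilter F ->
  (forall e : K, 0 < e -> exists x, F [set y | `|x - y| < e]) ->
  exists l, forall e : K, 0 < e -> F [set y | `|l - y| < e].
Proof.
case: hK F => R F FF cF; first exact: scalar_complete_real.
have normRe (z : R[i]) : `|complex.Re z|%:C <= `|z|.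
  case: z => a b; rewrite normc_def lecR -sqrtr_sqr ler_wsqrtr //=.
  by rewrite lerDl sqr_ge0.
have normIm (z : R[i]) : `|complex.Im z|%:C <= `|z|.
  case: z => a b; rewrite normc_def lecR -sqrtr_sqr ler_wsqrtr //=.
  by rewrite lerDr sqr_ge0.
have normD (z : R[i]) : `|z| <= (`|complex.Re z| + `|complex.Im z|)%:C.
  case: z => a b; rewrite normc_def lecR /=.
  rewrite -[leRHS]ger0_norm ?addr_ge0// -sqrtr_sqr ler_wsqrtr //.
  rewrite sqrrD !real_normK ?num_real// -addrA lerD2l lerDr.
  by rewrite mulrn_wge0 // mulr_ge0.
have ReB (z w : R[i]) : complex.Re (z - w) = complex.Re z - complex.Re w.
  by case: z w => [a b] [c d].
have ImB (z w : R[i]) : complex.Im (z - w) = complex.Im z - complex.Im w.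
  by case: z w => [a b] [c d].
have [|lr Hlr] := @scalar_complete_real R (@complex.Re R @ F) _.
  move=> e e0; have [|x Fx] := cF e%:C; first by rewrite ltcR.
  exists (complex.Re x); apply: (@filterS _ F _ _ _ _ Fx) => y /= xy.
  rewrite -ltcR; apply: le_lt_trans xy; by have := normRe (x - y); rewrite ReB.
have [|li Hli] := @scalar_complete_real R (@complex.Im R @ F) _.
  move=> e e0; have [|x Fx] := cF e%:C; first by rewrite ltcR.
  exists (complex.Im x); apply: (@filterS _ F _ _ _ _ Fx) => y /= xy.
  rewrite -ltcR; apply: le_lt_trans xy; by have := normIm (x - y); rewrite ImB.
exists (lr +i* li) => e e0.
have {e0} : 0 < complex.Re e /\ e = (complex.Re e)%:C.
  by move: e0; case: e => a b; rewrite ltcE /= => /andP[/eqP -> ->].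
move: (complex.Re e) => r [r0 ->].
have r20 : 0 < r / 2 by rewrite divr_gt0.
apply: (@filterS2 _ F _ _ _ _ _ (Hlr _ r20) (Hli _ r20)) => -[a b] /= h1 h2.
apply: le_lt_trans (normD _) _ => /=.
by rewrite ltcR [ltRHS](splitr r) ltrD.
Qed.

End ScalarTheory.

Definition bounded_linear (K : numFieldType) (V W : normedModType K)
    (f : V -> W) : Prop :=
  linear f /\ exists M : K, forall x, `|f x| <= M * `|x|.

Lemma ler_wnormMr (K : numFieldType) (y M t : K) :
  0 <= y -> 0 <= t -> y <= M * t -> y <= `|M| * t.
Proof.
move=> y0 t0 yMt; have := le_trans y0 yMt => /ger0_norm.
by rewrite normrM (ger0_norm t0) => ->.
Qed.

Section BoundedLinear.
Variables (K : numFieldType) (V W : normedModType K).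
Implicit Types f g : V -> W.

Lemma bounded_linearW f : bounded_linear f ->
  linear f /\ exists2 M : K, 0 <= M & forall x, `|f x| <= M * `|x|.
Proof.
case=> lf [M fM]; split=> //; exists `|M| => // x.
by rewrite (@ler_wnormMr _ _ M).
Qed.

Lemma bounded_linear0 : bounded_linear (0 : V -> W).
Proof.
split; first by move=> a x y; rewrite -[RHS]/(a *: (0 : W) + 0) scaler0 addr0.
by exists 0 => x; rewrite normr0 mul0r.
Qed.

Lemma bounded_linearZD a f g :
  bounded_linear f -> bounded_linear g -> bounded_linear (a *: f + g).
Proof.
move=> [lf [M fM]] [lg [N gN]]; split.
  move=> k x y; rewrite -[LHS]/(a *: f (k *: x + y) + g (k *: x + y)).
  rewrite -[RHS]/(k *: (a *: f x + g x) + (a *: f y + g y)).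
  rewrite lf lg !scalerDr !scalerA mulrC.
  by rewrite -!addrA; congr (_ + _); rewrite addrCA.
exists (`|a| * M + N) => x; rewrite mulrDl (le_trans (ler_normD _ _))// lerD//.
by rewrite normrZ -mulrA ler_wpM2l.
Qed.

End BoundedLinear.

(* Banach algebras need not be unital, so the product is not that of a ring
   structure. *)
HB.mixin Record isBanachAlgebra (K : numFieldType) A
    of CompleteNormedModule K A := {
  amul : A -> A -> A;
  amulA : associative amul;
  amul_linearl : forall b, linear (amul^~ b);
  amul_linearr : forall a, linear (amul a);
  amul_norm : forall a b, `|amul a b| <= `|a| * `|b|
}.

#[short(type="banachAlgType")]
HB.structure Definition BanachAlgebra (K : numFieldType) :=
  {A of CompleteNormedModule K A & isBanachAlgebra K A}.

(* The module actions are only required to be jointly bounded, with any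
   constant, and no unitality is imposed. *)
HB.mixin Record isBanachBimodule (K : numFieldType) (A : banachAlgType K) E
    of CompleteNormedModule K E := {
  lact : A -> E -> E;
  ract : E -> A -> E;
  lact_linearl : forall e, linear (lact^~ e);
  lact_linearr : forall a, linear (lact a);
  ract_linearl : forall a, linear (ract^~ a);
  ract_linearr : forall e, linear (ract e);
  lactA : forall a b e, lact (amul a b) e = lact a (lact b e);
  ractA : forall e a b, ract e (amul a b) = ract (ract e a) b;
  lractA : forall a e b, ract (lact a e) b = lact a (ract e b);
  lact_bounded : exists C : K, forall a e, `|lact a e| <= C * `|a| * `|e|;
  ract_bounded : exists C : K, forall e a, `|ract e a| <= C * `|a| * `|e|
}.

#[short(type="banachBimodType")]
HB.structure Definition BanachBimodule (K : numFieldType)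
    (A : banachAlgType K) :=
  {E of CompleteNormedModule K E & isBanachBimodule K A E}.

Section BimoduleBound.
Variables (K : numFieldType) (A : banachAlgType K) (E : banachBimodType A).

Lemma lact_boundedW : exists2 C : K, 0 <= C &
  forall (a : A) (e : E), `|lact a e| <= C * `|a| * `|e|.
Proof.
have [C hC] := @lact_bounded K A E; exists `|C| => // a e.
by rewrite -mulrA ler_wnormMr// ?mulr_ge0// mulrA.
Qed.

Lemma ract_boundedW : exists2 C : K, 0 <= C &
  forall (e : E) (a : A), `|ract e a| <= C * `|a| * `|e|.
Proof.
have [C hC] := @ract_bounded K A E; exists `|C| => // a e.
by rewrite -mulrA ler_wnormMr// ?mulr_ge0// mulrA.
Qed.

End BimoduleBound.

Section Dual.
Variables (K : numFieldType) (hK : real_or_complex K) (V : normedModType K).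

Definition functional : {pred V -> K^o} := [pred f | `[< bounded_linear f >]].

Lemma functionalP (f : V -> K^o) :
  reflect (bounded_linear f) (f \in functional).
Proof. exact: asboolP. Qed.

Lemma functional_submod_closed : submod_closed functional.
Proof.
split=> [|a f g]; first by apply/functionalP; exact: bounded_linear0.
move=> /functionalP fb /functionalP gb; apply/functionalP.
exact: bounded_linearZD.
Qed.

HB.instance Definition _ :=
  GRing.isSubmodClosed.Build K (V -> K^o) functional functional_submod_closed.

(* The parameter [hK] is what makes the supremum defining the norm exist. *)
Record dual (h : real_or_complex K) :=
  Dual { dual_fun :> V -> K^o; _ : dual_fun \in functional }.

HB.instance Definition _ := [isSub for @dual_fun hK].
HB.instance Definition _ := [Choice of dual hK by <:].
HB.instance Definition _ := [SubChoice_isSubLmodule of dual hK by <:].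

Implicit Types f g : dual hK.

Lemma dualP f : bounded_linear f.
Proof. by case: f => f /= /functionalP. Qed.

Definition dual_norm f : K :=
  supremum 0 [set `|f x| | x in [set x : V | `|x| <= 1]].

Lemma dual_norm_supremums f :
  supremums [set `|f x| | x in [set x : V | `|x| <= 1]] (dual_norm f).
Proof.
set S := [set _ | _ in _].
have S0 : S !=set0 by exists `|f 0|; exists 0; rewrite //= normr0.
have [||M SM] := scalar_sup hK S0.
- by move=> _ [x _ <-].
- have [_ [M M0 fM]] := bounded_linearW (dualP f).
  by exists M => _ [x /= x1 <-]; rewrite (le_trans (fM x))// ler_piMr.
rewrite /dual_norm -/S /supremum ifF; last exact/negbTE/set0P.
exact: (xgetPex 0 (ex_intro _ M SM)).
Qed.

Lemma dual_norm_ub f x : `|x| <= 1 -> `|f x| <= dual_norm f.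
Proof. by move=> x1; apply: (dual_norm_supremums f).1; exists x. Qed.

Lemma dual_norm_le f M :
  (forall x, `|x| <= 1 -> `|f x| <= M) -> dual_norm f <= M.
Proof. by move=> fM; apply: (dual_norm_supremums f).2 => _ [x + <-] => /fM. Qed.

Lemma dual_norm_ge0 f : 0 <= dual_norm f.
Proof. by apply: le_trans (@dual_norm_ub f 0 _); rewrite ?normr0. Qed.

Lemma dual0 f : f 0 = 0.
Proof.
have [lf _] := dualP f; have := lf (-1) 0 0.
by rewrite scaler0 addr0 scaleN1r addNr.
Qed.

Lemma dualZ f a x : f (a *: x) = a *: f x.
Proof. by have [lf _] := dualP f; rewrite -[a *: x]addr0 lf dual0 addr0. Qed.

Lemma dual_normP f x : `|f x| <= dual_norm f * `|x|.
Proof.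
have [->|x0] := eqVneq x 0; first by rewrite dual0 !normr0 mulr0.
have nx : 0 < `|x| by rewrite normr_gt0.
rewrite -ler_pdivrMr//.
have := @dual_norm_ub f (`|x|^-1 *: x).
rewrite dualZ !normrZ normfV normr_id mulVf ?lt0r_neq0// => /(_ (lexx _)).
by rewrite mulrC.
Qed.

Lemma dual_norm_bound f M :
  0 <= M -> (forall x, `|f x| <= M * `|x|) -> dual_norm f <= M.
Proof.
by move=> M0 fM; apply: dual_norm_le => x x1; rewrite (le_trans (fM x))// ler_piMr.
Qed.

Lemma ler_dual_normD f g : dual_norm (f + g) <= dual_norm f + dual_norm g.
Proof.
apply: dual_norm_le => x x1; rewrite (le_trans (ler_normD _ _))//.
by rewrite lerD// dual_norm_ub.
Qed.

Lemma dual_normZ (l : K) f : dual_norm (l *: f) = `|l| * dual_norm f.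
Proof.
have le a h : dual_norm (a *: h) <= `|a| * dual_norm h.
  apply: dual_norm_le => x x1.
  by rewrite [X in `|X|](_ : _ = a *: h x)// normrZ ler_wpM2l// dual_norm_ub.
have [->|l0] := eqVneq l 0.
  apply/eqP; rewrite eq_le le /= normr0 mul0r; exact: dual_norm_ge0.
apply/eqP; rewrite eq_le le /= -ler_pdivlMl ?normr_gt0// -normfV.
by rewrite (le_trans _ (le _ _))// scalerA mulVf// scale1r.
Qed.

Lemma dual_norm_eq0 f : dual_norm f = 0 -> f = 0.
Proof.
move=> f0; apply/val_inj/funext => x /=; apply/eqP; rewrite -normr_le0.
by rewrite (le_trans (dual_normP f x))// f0 mul0r.
Qed.

HB.instance Definition _ := @Lmodule_isNormed.Build K (dual hK)
  dual_norm ler_dual_normD dual_normZ dual_norm_eq0.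

Lemma dual_complete (F : set_system (dual hK)) :
  ProperFilter F -> cauchy F -> cvg F.
Proof.
move=> FF /cauchyP cF.
have {}cF e : 0 < e -> exists f, F [set g | `|f - g| < e].
  by move=> /cF[f Ff]; exists f; move: Ff; rewrite -ball_normE.
have Hx x : exists l : K, forall e, 0 < e -> F [set g : dual hK | `|l - g x| < e].
  apply: (@scalar_complete _ hK ((fun g : dual hK => g x : K) @ F)) => e e0.
  have ex0 : 0 < e / (`|x| + 1) by rewrite divr_gt0// ltr_wpDl.
  have [f Ff] := cF _ ex0; exists (f x); apply: (@filterS _ F _ _ _ _ Ff) => g /= fg.
  rewrite -[X in `|X|]/((f - g) x) (le_lt_trans (dual_normP _ _))//.
  rewrite -[dual_norm _]/`|f - g| (@le_lt_trans _ _ (`|f - g| * (`|x| + 1)))//.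
    by rewrite ler_wpM2l// lerDl.
  by rewrite -ltr_pdivlMr// ltr_wpDl.
have [l Hl] := choice Hx.
have cl x : (fun g : dual hK => (g x : K^o)) @ F --> (l x : K^o).
  by apply/cvgrPdist_lt => e e0; exact: Hl.
have ll : linear (l : V -> K^o).
  move=> a x y; apply: (cvg_unique _ (cl (a *: x + y))) => //.
  rewrite (_ : (fun g => _) = (fun g : dual hK => a *: (g x : K^o) + (g y : K^o))).
    by apply: cvgD; [apply: cvgZr|]; exact: cl.
  by apply/funext => g; have [lg _] := dualP g; exact: lg.
have lF e f : 0 < e -> F [set g | `|f - g| < e] ->
    forall x, `|f x - l x| <= e * `|x|.
  move=> e0 Ff x; apply/ler_addgt0Pr => d d0.
  have [g /= [fg lg]] := filter_ex (filterI Ff (Hl x _ d0)).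
  rewrite -(subrKA (g x)) (le_trans (ler_normD _ _))// lerD//.
    by rewrite -[X in `|X|]/((f - g) x) (le_trans (dual_normP _ _))// ler_wpM2r// ltW.
  by rewrite distrC ltW.
have lb : bounded_linear (l : V -> K^o).
  split=> //; have [f Ff] := cF _ ltr01.
  exists (dual_norm f + 1) => x; rewrite mulrDl.
  rewrite -[l x](subKr (f x)) (le_trans (ler_normB _ _))// lerD//.
    exact: dual_normP.
  exact: lF Ff x.
have lfun : (l : V -> K^o) \in functional.
  by exact/functionalP.
apply/cvg_ex; exists (Dual hK lfun); apply/cvgrPdist_le => e e0.
have e20 : 0 < e / 2 by rewrite divr_gt0.
have [f Ff] := cF _ e20; apply: filterS (Ff) => g /= fg.
rewrite (splitr e) -(subrKA f) (le_trans (ler_normD _ _))// lerD ?(ltW fg)//.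
rewrite distrC; apply: dual_norm_bound; first exact: ltW.
by move=> x; exact: lF.
Qed.

HB.instance Definition _ :=
  Uniform_isComplete.Build (dual hK) dual_complete.

End Dual.

Section DualBimodule.
Variables (K : numFieldType) (hK : real_or_complex K).
Variables (A : banachAlgType K) (E : banachBimodType A).
Implicit Types (f : dual E hK) (a b : A).

Lemma dual_lact_subproof a f :
  (fun e : E => f (ract e a)) \in functional (V := E).
Proof.
have [lf [M M0 fM]] := bounded_linearW (dualP f).
have [C C0 hC] := ract_boundedW E.
apply/functionalP; split=> [k x y|]; first by rewrite ract_linearl lf.
exists (M * (C * `|a|)) => x; rewrite (le_trans (fM _))//.
by rewrite -mulrA ler_wpM2l.
Qed.

Lemma dual_ract_subproof f a :
  (fun e : E => f (lact a e)) \in functional (V := E).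
Proof.
have [lf [M M0 fM]] := bounded_linearW (dualP f).
have [C C0 hC] := lact_boundedW E.
apply/functionalP; split=> [k x y|]; first by rewrite lact_linearr lf.
exists (M * (C * `|a|)) => x; rewrite (le_trans (fM _))//.
by rewrite -mulrA ler_wpM2l.
Qed.

(* <a f, e> = <f, e a> and <f a, e> = <f, a e>. *)
Definition dual_lact a f : dual E hK := Dual hK (dual_lact_subproof a f).
Definition dual_ract f a : dual E hK := Dual hK (dual_ract_subproof f a).

Lemma dual_ext f (g : dual E hK) : f =1 g -> f = g.
Proof. by move=> fg; apply/val_inj/funext. Qed.

Lemma dual_lact_linearl f : linear (dual_lact^~ f).
Proof.
have [lf _] := dualP f.
by move=> k a b; apply: dual_ext => x /=; rewrite ract_linearr lf.
Qed.

Lemma dual_lact_linearr a : linear (dual_lact a).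
Proof. by move=> k f g; apply: dual_ext. Qed.

Lemma dual_ract_linearl a : linear (dual_ract^~ a).
Proof. by move=> k f g; apply: dual_ext. Qed.

Lemma dual_ract_linearr f : linear (dual_ract f).
Proof.
have [lf _] := dualP f.
by move=> k a b; apply: dual_ext => x /=; rewrite lact_linearl lf.
Qed.

Lemma dual_lactA a b f :
  dual_lact (amul a b) f = dual_lact a (dual_lact b f).
Proof. by apply: dual_ext => x /=; rewrite ractA. Qed.

Lemma dual_ractA f a b :
  dual_ract f (amul a b) = dual_ract (dual_ract f a) b.
Proof. by apply: dual_ext => x /=; rewrite lactA. Qed.

Lemma dual_lractA a f b :
  dual_ract (dual_lact a f) b = dual_lact a (dual_ract f b).
Proof. by apply: dual_ext => x /=; rewrite lractA. Qed.

Lemma dual_lact_bounded :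
  exists C : K, forall a f, `|dual_lact a f| <= C * `|a| * `|f|.
Proof.
have [C C0 hC] := ract_boundedW E; exists C => a f.
apply: dual_norm_bound => [|x]; first by rewrite !mulr_ge0.
by rewrite (le_trans (dual_normP f _))// mulrC mulrAC ler_wpM2r// dual_norm_ge0.
Qed.

Lemma dual_ract_bounded :
  exists C : K, forall f a, `|dual_ract f a| <= C * `|a| * `|f|.
Proof.
have [C C0 hC] := lact_boundedW E; exists C => f a.
apply: dual_norm_bound => [|x]; first by rewrite !mulr_ge0.
by rewrite (le_trans (dual_normP f _))// mulrC mulrAC ler_wpM2r// dual_norm_ge0.
Qed.

HB.instance Definition _ := isBanachBimodule.Build K A (dual E hK)
  dual_lact_linearl dual_lact_linearr dual_ract_linearl dual_ract_linearr
  dual_lactA dual_ractA dual_lractA dual_lact_bounded dual_ract_bounded.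

End DualBimodule.

Fixpoint iterated_dual (K : numFieldType) (hK : real_or_complex K)
    (A : banachAlgType K) (B : banachBimodType A) (n : nat) :
    banachBimodType A :=
  if n is m.+1 then dual (iterated_dual hK B m) hK : banachBimodType A else B.

Section Cohomology.
Variables (K : numFieldType) (A : banachAlgType K) (E : banachBimodType A).

Definition is_derivation : {pred A -> E} := [pred D | `[< bounded_linear D /\
  forall x y : A, D (amul x y) = lact x (D y) + ract (D x) y >]].

Lemma is_derivationP (D : A -> E) :
  reflect (bounded_linear D /\
           forall x y : A, D (amul x y) = lact x (D y) + ract (D x) y)
          (D \in is_derivation).
Proof. exact: asboolP. Qed.

Lemma is_derivation_submod_closed : submod_closed is_derivation.
Proof.
have lact0 a : lact a (0 : E) = 0.
  by have := lact_linearr a (-1) 0 (0 : E); rewrite scaler0 addr0 scaleN1r addNr.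
have ract0 a : ract (0 : E) a = 0.
  by have := ract_linearl a (-1) 0 (0 : E); rewrite scaler0 addr0 scaleN1r addNr.
split=> [|k D1 D2].
  apply/is_derivationP; split; first exact: bounded_linear0.
  by move=> x y; rewrite lact0 ract0 addr0.
move=> /is_derivationP[b1 h1] /is_derivationP[b2 h2].
apply/is_derivationP; split; first exact: bounded_linearZD.
move=> x y; rewrite -[LHS]/(k *: D1 (amul x y) + D2 (amul x y)).
rewrite -[in lact _ _]/(k *: D1 y + D2 y) -[in ract _ _]/(k *: D1 x + D2 x).
by rewrite lact_linearr ract_linearl h1 h2 scalerDr addrACA.
Qed.

HB.instance Definition _ := GRing.isSubmodClosed.Build K (A -> E)
  is_derivation is_derivation_submod_closed.

Record Z1 := Derivation {
  derivation_fun :> A -> E;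
  _ : derivation_fun \in is_derivation }.

HB.instance Definition _ := [isSub for derivation_fun].
HB.instance Definition _ := [Choice of Z1 by <:].
HB.instance Definition _ := [SubChoice_isSubLmodule of Z1 by <:].

Definition inner (e : E) : A -> E := fun a => lact a e - ract e a.

Lemma inner_is_derivation e : inner e \in is_derivation.
Proof.
have [C C0 hC] := lact_boundedW E; have [C' C'0 hC'] := ract_boundedW E.
apply/is_derivationP; split; first split.
- move=> k a b; rewrite /inner lact_linearl ract_linearr.
  by rewrite scalerBr opprD addrACA.
- exists ((C + C') * `|e|) => a; rewrite (le_trans (ler_normB _ _))//.
  by rewrite mulrAC !mulrDl lerD.
- have lactB x (u v : E) : lact x (u - v) = lact x u - lact x v.
    by rewrite addrC -scaleN1r lact_linearr scaleN1r addrC.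
  have ractB x (u v : E) : ract (u - v) x = ract u x - ract v x.
    by rewrite addrC -scaleN1r ract_linearl scaleN1r addrC.
  by move=> x y; rewrite /inner lactB ractB lactA ractA lractA subrKA.
Qed.

Definition N1 : {pred Z1} := [pred D : Z1 | `[< exists e, D =1 inner e >]].

Lemma N1P (D : Z1) : reflect (exists e, D =1 inner e) (D \in N1).
Proof. exact: asboolP. Qed.

Lemma N1_submod_closed : submod_closed N1.
Proof.
have lin k (u v : E) a :
    inner (k *: u + v) a = k *: inner u a + inner v a.
  by rewrite /inner lact_linearr ract_linearl scalerBr opprD addrACA.
split=> [|k D1 D2].
  apply/N1P; exists 0 => a; have := lin (-1) 0 0 a.
  by rewrite scaler0 addr0 scaleN1r addNr.
move=> /N1P[e1 h1] /N1P[e2 h2]; apply/N1P; exists (k *: e1 + e2) => a.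
by rewrite lin -h1 -h2.
Qed.

HB.instance Definition _ := GRing.isSubmodClosed.Build K Z1 N1 N1_submod_closed.

(* The quotient is taken in the library's category of additive groups; the
   induced scaling plays no role in its triviality. *)
Definition H1 := Quotient.quot N1.

HB.instance Definition _ := GRing.Zmodule.on H1.

End Cohomology.

(* Main.v *)
Require Import Defs.
From mathcomp Require Import all_boot all_order all_algebra.
From mathcomp Require Import all_classical normedtype.
Import Order.TTheory GRing.Theory Num.Theory.

Set Implicit Arguments.
Unset Strict Implicit.
Unset Printing Implicit Defensive.

Local Open Scope ring_scope.

(** Write [J_E] for the canonical embedding of [E] into its bidual. For
    [n >= 1] the module [B^(n)] is the dual [X'] of [X = B^(n-1)], and a dual is
    always a bimodule retract of its own bidual: the adjoint [P : X''' -> X'] of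
    [J_X], which is restriction of functionals to [X], is a left inverse of
    [J_X'] ([adjoint_bidual_emb]), and both are bimodule maps. Vanishing of
    [H^1] passes to retracts ([H1_retract]): if [D : A -> X'] is a derivation
    then so is its composite with [J_X'], hence [J_X' (D a) = a e - e a] for
    some [e] in [X'''], and applying [P] gives [D a = a (P e) - (P e) a]. For
    [n = 0] this argument has no starting point, [B] being an arbitrary module
    rather than a dual. *)

Lemma H1_eq0P (K : numFieldType) (A : banachAlgType K) (E : banachBimodType A) :
  (forall h : H1 E, h = 0) <-> (forall D : Z1 E, exists e, D =1 inner e).
Proof.
have piE (D : Z1 E) :
    (\pi_(H1 E) D)%qT = 0 <-> exists e, D =1 inner e.
  have -> : 0 = (\pi_(H1 E) 0)%qT by rewrite pi_zeror.
  have -> : (\pi_(H1 E) D = \pi_(H1 E) 0)%qT <-> D \in @N1 K A E.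
    by rewrite -[D in D \in _]subr0 Quotient.idealrBE; split=> /eqP.
  by split=> /N1P.
split=> [H1_0 D | inner_all h]; first exact/piE/H1_0.
by rewrite -[h]reprK; apply/piE/inner_all.
Qed.

Section BimoduleMaps.
Variables (K : numFieldType) (A : banachAlgType K).
Implicit Types E F : banachBimodType A.

Definition bimodule_map E F (f : E -> F) : Prop :=
  [/\ linear f, (forall a x, f (lact a x) = lact a (f x))
    & forall x a, f (ract x a) = ract (f x) a].

Lemma bimodule_mapD E F (f : E -> F) : bimodule_map f -> {morph f : x y / x + y}.
Proof. by case=> lf _ _ x y; have := lf 1 x y; rewrite !scale1r. Qed.

Lemma bimodule_map_inner E F (f : E -> F) (e : E) (a : A) :
  bimodule_map f -> f (inner e a) = inner (f e) a.
Proof.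
move=> [lf fl fr]; rewrite /inner addrC -scaleN1r lf fl fr.
by rewrite scaleN1r addrC.
Qed.

Lemma derivation_comp E F (J : E -> F) (D : A -> E) :
  bounded_linear J -> bimodule_map J ->
  D \in @is_derivation K A E -> J \o D \in @is_derivation K A F.
Proof.
move=> bJ mJ /is_derivationP[[lD [M DM]] derD].
have [lJ [C C0 JC]] := bounded_linearW bJ; have [_ Jl Jr] := mJ.
apply/is_derivationP; split; first split.
- by move=> k x y /=; rewrite lD lJ.
- exists (C * M) => x /=; rewrite (le_trans (JC _))// -mulrA.
  exact: ler_wpM2l.
- by move=> x y /=; rewrite derD (bimodule_mapD mJ) Jl Jr.
Qed.

(** Derivations are pushed forward along [J]; inner derivations are natural in
    bimodule maps, so an implementing element in [F] is carried back by [P]. *)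
Lemma H1_retract E F (J : E -> F) (P : F -> E) :
  bounded_linear J -> bimodule_map J -> bimodule_map P -> cancel J P ->
  (forall h : H1 F, h = 0) -> forall h : H1 E, h = 0.
Proof.
move=> bJ mJ mP JK /H1_eq0P inF; apply/H1_eq0P => D.
have [D' derD'] : exists D' : Z1 F, D' =1 J \o D.
  by exists (Derivation (derivation_comp bJ mJ (valP D))).
have [e D'e] := inF D'; exists (P e) => a.
by rewrite -bimodule_map_inner// -D'e derD' /= JK.
Qed.

End BimoduleMaps.

Section Bidual.
Variables (K : numFieldType) (hK : real_or_complex K) (A : banachAlgType K).
Implicit Types E F : banachBimodType A.

Lemma adjoint_subproof E F (T : E -> F) (bT : bounded_linear T)
  (g : dual F hK) : (g \o T : E -> K^o) \in functional (V := E).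
Proof.
have [lT [M M0 TM]] := bounded_linearW bT; have [lg _] := dualP g.
apply/functionalP; split=> [k x y|]; first by rewrite /= lT lg.
exists (dual_norm g * M) => x; rewrite (le_trans (dual_normP g _))// -mulrA.
by rewrite ler_wpM2l// dual_norm_ge0.
Qed.

Definition adjoint E F (T : E -> F) (bT : bounded_linear T) (g : dual F hK) :
  dual E hK := Dual hK (adjoint_subproof bT g).

Lemma adjoint_bimodule_map E F (T : E -> F) (bT : bounded_linear T) :
  bimodule_map T -> bimodule_map (adjoint bT : dual F hK -> dual E hK).
Proof.
case=> _ Tl Tr; split=> [k f g|a g|g a]; apply: dual_ext => x //=.
- by rewrite Tr.
- by rewrite Tl.
Qed.

Lemma bidual_emb_subproof E (e : E) :
  (fun f : dual E hK => f e : K^o) \in functional (V := dual E hK).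
Proof.
apply/functionalP; split=> //; exists `|e| => f.
by rewrite (le_trans (dual_normP f e))// mulrC.
Qed.

Definition bidual_emb E (e : E) : dual (dual E hK) hK :=
  Dual hK (bidual_emb_subproof e).

Lemma bidual_emb_bounded E : bounded_linear (@bidual_emb E).
Proof.
split=> [k x y|].
  by apply: dual_ext => f /=; have [lf _] := dualP f; rewrite lf.
exists 1 => e; rewrite mul1r; apply: dual_norm_bound => // f.
by rewrite (le_trans (dual_normP f e))// mulrC.
Qed.

(** Both actions are dualized twice, so the two exchanges of sides cancel. *)
Lemma bidual_emb_bimodule_map E : bimodule_map (@bidual_emb E).
Proof.
by split=> [|a x|x a]; [exact: (bidual_emb_bounded E).1 | apply: dual_ext..].
Qed.

(** The triangle identity of the contravariant duality: restricting evaluation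
    at [f] to the points of [E] returns [f]. *)
Lemma adjoint_bidual_emb E :
  cancel (@bidual_emb (dual E hK)) (adjoint (bidual_emb_bounded E)).
Proof. by move=> f; apply: dual_ext. Qed.

End Bidual.

Theorem mainTheorem1 (K : numFieldType) (hK : real_or_complex K)
    (A : banachAlgType K) (B : banachBimodType A) (n : nat) :
  (1 <= n)%N ->
  (forall h : H1 (iterated_dual hK B n.+2), h = 0) ->
  (forall h : H1 (iterated_dual hK B n), h = 0).
Proof.
case: n => [//|m] _; set X := iterated_dual hK B m.
apply: (@H1_retract _ _ _ _ (@bidual_emb K hK A (dual X hK))
  (adjoint (bidual_emb_bounded hK X))).
- exact: bidual_emb_bounded.
- exact: bidual_emb_bimodule_map.
- exact/adjoint_bimodule_map/bidual_emb_bimodule_map.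
- exact: adjoint_bidual_emb.
Qed.
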